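(* For every $\delta>0$ there is $c>0$ such that every $N$-vertex graph $G$ that contains a $\delta$-diverse set of size at least $N^{2/3}$ has an induced subgraph with at least $cN^{2/3}$ distinct degrees.
   Context: Graphs are finite and simple, and $N_G(u)$ denotes the neighbourhood of $u$ in $G$. A set $U\subset V(G)$ is $\delta$-diverse if $|N_G(u)\triangle N_G(u')|\ge \delta|V(G)|$ for all distinct $u,u'\in U$. A graph $H$ has at least $m$ distinct degrees if the set $\{d_H(v):v\in V(H)\}$ has at least $m$ elements. *)

(* Defs.v *)
From HB Require Import structures.
From mathcomp Require Import all_boot all_order all_algebra.
From mathcomp Require Import reals exp.

Set Implicit Arguments.
Unset Strict Implicit.
Unset Printing Implicit Defensive.

Import Order.TTheory GRing.Theory Num.Theory.
Local Open Scope ring_scope.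

Record sgraph := SGraph {
  svertex :> finType;
  sedge : rel svertex;
  sedge_sym : symmetric sedge;
  sedge_irrefl : irreflexive sedge }.

Definition nbhd (G : sgraph) (u : G) : {set G} := [set v | sedge u v].

Definition degree (G : sgraph) (u : G) : nat := #|nbhd u|.

Definition symdiff (T : finType) (A B : {set T}) : {set T} :=
  (A :\: B) :|: (B :\: A).

Definition diverse (R : realType) (delta : R) (G : sgraph) (U : {set G}) : Prop :=
  forall u u' : G, u \in U -> u' \in U -> u != u' ->
    delta * #|G|%:R <= #|symdiff (nbhd u) (nbhd u')|%:R.

Section Induced.
Variables (G : sgraph) (W : {set G}).

Definition induced_edge : rel {x : G | x \in W} :=
  fun x y => sedge (val x) (val y).

Lemma induced_edge_sym : symmetric induced_edge.
Proof. by move=> x y; apply: sedge_sym. Qed.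

Lemma induced_edge_irrefl : irreflexive induced_edge.
Proof. by move=> x; apply: sedge_irrefl. Qed.

Definition induced : sgraph := SGraph induced_edge_sym induced_edge_irrefl.
End Induced.

Definition num_distinct_degrees (H : sgraph) : nat :=
  size (undup [seq degree v | v : H]).

(* Main.v *)
Require Import Defs.
From mathcomp Require Import all_boot all_order all_algebra.
From mathcomp Require Import reals exp.
From mathcomp Require Import zify.

Set Implicit Arguments.
Unset Strict Implicit.
Unset Printing Implicit Defensive.

Import Order.TTheory GRing.Theory Num.Theory.
Local Open Scope ring_scope.

(** Write K for N^(2/3) and shrink the diverse set to a set U of K vertices.
  It suffices to find a random W containing U such that any two vertices of U
  have the same degree in W with probability O(1/K), up to an exceptional event
  common to all pairs, of probability at most 1/2: on average there are then
  O(K) colliding pairs in U, and by Cauchy-Schwarz ([card_collisions]) the K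
  degrees of the vertices of U take at least a constant multiple of K values.

  An unbiased random W only spreads the degrees over a window of length N^(1/2),
  so W has to be biased at random along the neighbourhoods of U themselves.
  Each w in U receives an independent uniform weight in [-K, K], the shift of a
  vertex v is the sum of the weights of its neighbours in U, and v outside U
  enters W when its shift exceeds a level which is uniform in [-H, H]. The shift
  of v has variance at most K * K^2 = K^3 <= N^2, so with H a large multiple of N
  most shifts stay inside the window ([sum_card_wild], [card_tame]); this is
  where the exponent 2/3 comes from.

  Fix u and u' in U and assume that N(u) \ N(u') is large. If the weight of u
  grows and everything else is kept, then d_W(u) - d_W(u') can only grow, because
  the only vertices affected are neighbours of u. Call an outcome critical if the
  two degrees agree and some private neighbour of u, that is, some vertex of
  N(u) \ N(u') outside U, sits right at its threshold, so that moving the weight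
  of u by one unit in the proper direction breaks the tie. By monotonicity only
  two values of the weight of u can be critical, and critical outcomes have
  probability O(1/K) ([card_critical]). In a tie that is not critical, if most
  shifts are inside the window, about N private neighbours of u can have their
  level moved to the threshold without changing W. Each such move leads to a
  critical outcome and forgets only one level, out of about N possible ones;
  hence ties that are not critical are at most a constant factor more frequent
  than critical outcomes ([card_stuck]). Both counts together give the bound
  O(1/K) ([card_collision]).

  All probabilities are expressed as cardinalities over the finite product of the
  possible weights and levels. *)

(** * Finite functions changed at one point *)

Definition upd {T : finType} {A : Type} (f : {ffun T -> A}) (u : T) (a : A) :
  {ffun T -> A} := [ffun w => if w == u then a else f w].

Lemma upd_at {T : finType} {A : Type} (f : {ffun T -> A}) u a : upd f u a u = a.
Proof. by rewrite ffunE eqxx. Qed.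

Lemma upd_off {T : finType} {A : Type} (f : {ffun T -> A}) u a w :
  w != u -> upd f u a w = f w.
Proof. by rewrite ffunE => /negbTE ->. Qed.

(** A set that meets every line in direction u at most once has density at most
  1/n: moving its points along these lines gives n disjoint copies of it. *)
Lemma card_line_section (T B : finType) (n : nat) (u : T)
    (E : {set {ffun T -> 'I_n} * B}) :
  (forall e e', e \in E -> e' \in E ->
     (forall w, w != u -> e.1 w = e'.1 w) -> e.2 = e'.2 -> e.1 u = e'.1 u) ->
  (n * #|E| <= #|{: {ffun T -> 'I_n} * B}|)%N.
Proof.
move=> one.
pose move_to (p : ({ffun T -> 'I_n} * B) * 'I_n) := (upd p.1.1 u p.2, p.1.2).
have inj : {in setX E [set: 'I_n] &, injective move_to}.
  move=> [[s t] a] [[s' t'] a'] /setXP[/= Ee _] /setXP[/= Ee' _] [/ffunP eq_s eq_t].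
  have eq_a : a = a' by have := eq_s u; rewrite !upd_at.
  have off w : w != u -> s w = s' w.
    by move=> wu; have := eq_s w; rewrite !upd_off.
  have eq_u := one _ _ Ee Ee' off eq_t; rewrite /= in eq_u.
  congr (_, _, _) => //; apply/ffunP => w.
  by have [->|/off] := eqVneq w u.
have := max_card [in move_to @: setX E [set: 'I_n]].
by rewrite (card_in_imset inj) cardsX cardsT card_ord mulnC.
Qed.

(** * Counting values through collisions *)

(** Cauchy-Schwarz: if the d values of f have fibres of sizes a_1, ..., a_d in U,
  then (sum a_i)^2 <= d * sum a_i^2, and sum a_i^2 counts the collisions. *)
Lemma card_collisions (T : finType) (U : {set T}) (f : T -> nat) :
  (#|U| ^ 2 <= size (undup [seq f u | u in U]) *
     #|[set p in setX U U | f p.1 == f p.2]|)%N.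
Proof.
set r := undup _.
pose a (d : nat) := #|[set u in U | f u == d]|.
have mem_r u : u \in U -> f u \in r.
  by move=> uU; rewrite mem_undup; apply/imageP; exists u.
have r_uniq : uniq r by exact: undup_uniq.
have sumU (F : nat -> nat) : (\sum_(u in U) F (f u) = \sum_(d <- r) a d * F d)%N.
  rewrite (eq_bigr (fun u => \sum_(d <- r) if f u == d then F d else 0))%N.
    rewrite exchange_big /=; apply: eq_bigr => d _.
    rewrite -big_mkcondr /= sum_nat_const; congr (_ * _)%N.
    by apply: eq_card => u; rewrite !inE.
  move=> u uU; rewrite (bigD1_seq (f u)) ?mem_r //= eqxx big1 ?addn0 // => d.
  by rewrite eq_sym => /negbTE ->.
have -> : #|U| = (\sum_(d <- r) a d)%N.
  by rewrite -sum1_card (sumU (fun=> 1%N)); under eq_bigr do rewrite muln1.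
have -> : #|[set p in setX U U | f p.1 == f p.2]| = (\sum_(d <- r) a d * a d)%N.
  rewrite -sumU -sum1_card; under [in RHS]eq_bigr do rewrite /a -sum1_card.
  rewrite pair_big_dep /=; apply: eq_bigl => -[u v].
  by rewrite !inE /= andbA [f v == _]eq_sym.
rewrite -mulnn big_distrlr /= -(leq_pmul2l (isT : 0 < 2)%N).
have -> : (2 * (size r * \sum_(d <- r) a d * a d) =
    \sum_(d <- r) \sum_(e <- r) (a d ^ 2 + a e ^ 2))%N.
  under [in RHS]eq_bigr => d _.
    rewrite big_split /= big_const_seq count_predT iter_addn_0 -mulnn.
    under eq_bigr => e _ do rewrite -mulnn.
    over.
  rewrite /= big_split /= big_const_seq count_predT iter_addn_0 -big_distrl /=.
  by rewrite mul2n -addnn mulnC.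
rewrite big_distrr /=; apply: leq_sum => d _.
by rewrite big_distrr /=; apply: leq_sum => e _; apply: nat_Cauchy.
Qed.

Lemma sumz_const (T : finType) (A : {pred T}) (a : nat) :
  \sum_(x in A) a%:Z = (#|A| * a)%N%:Z.
Proof. by rewrite sumr_const -mulr_natr natz -PoszM mulnC. Qed.

(** * The random vertex set *)

Section RandomSample.
Variables (G : sgraph) (U : {set G}) (m H : nat).

Notation weights := {ffun G -> 'I_(m.*2.+1)}.
Notation thresholds := {ffun G -> 'I_(H.*2.+1)}.
Implicit Types (s : weights) (t : thresholds) (e : weights * thresholds).

Definition weight s w : int := (s w)%:Z - m%:Z.
Definition shift s v : int := \sum_(w in U | sedge w v) weight s w.
Definition level t v : int := (t v)%:Z - H%:Z.
Definition sample e : {set G} := U :|: [set v | level e.2 v < shift e.1 v].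
Definition sdeg e u : nat := #|nbhd u :&: sample e|.
(** Vertices of U are left out because they belong to every sample. *)
Definition private_nbhd (u u' : G) : {set G} := nbhd u :\: nbhd u' :\: U.

Lemma sample_notin e v : v \notin U -> (v \in sample e) = (level e.2 v < shift e.1 v).
Proof. by move=> vU; rewrite !inE (negbTE vU). Qed.

Lemma shift_line s s' u v : u \in U -> (forall w, w != u -> s w = s' w) ->
  shift s' v = shift s v + (if v \in nbhd u then (s' u)%:Z - (s u)%:Z else 0).
Proof.
move=> uU off; rewrite inE; case: ifP => [uv|nuv].
  have split_u r : shift r v =
      weight r u + \sum_(w in U | sedge w v && (w != u)) weight r w.
    rewrite /shift (bigD1 u) /= ?uU //; congr (_ + _).
    by apply: eq_bigl => w; rewrite andbA.
  rewrite !split_u; under [in LHS]eq_bigr => w /and3P[_ _ wu].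
    rewrite /weight -(off w wu); over.
  by rewrite -!addrA; move: (\sum_(w in U | _) _) => S; rewrite /weight; lia.
rewrite addr0; apply: eq_bigr => w /andP[_ wv]; rewrite /weight off //.
by apply: contraTneq wv => ->; rewrite nuv.
Qed.

(** Common neighbours contribute equally to both degrees. *)
Lemma sdeg_eq_private e u u' :
  (sdeg e u == sdeg e u') =
  (#|(nbhd u :\: nbhd u') :&: sample e| == #|(nbhd u' :\: nbhd u) :&: sample e|).
Proof.
rewrite /sdeg -(cardsID (nbhd u')) -[in X in _ == X](cardsID (nbhd u)).
have -> : nbhd u :&: sample e :&: nbhd u' = nbhd u' :&: sample e :&: nbhd u.
  by rewrite setIC setIA setIAC.
by rewrite eqn_add2l !setIDAC.
Qed.

(** The monotonicity at the heart of the argument. Raising the weight of u only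
  adds neighbours of u to the sample, and the part of N(u') outside N(u) does not
  move at all; so if the degrees of u and u' agree at both ends, no private
  neighbour of u can have been added. *)
Lemma sdeg_eq_line s s' t u u' v : u \in U ->
  (forall w, w != u -> s w = s' w) -> (s u < s' u)%N ->
  sdeg (s, t) u = sdeg (s, t) u' -> sdeg (s', t) u = sdeg (s', t) u' ->
  v \in private_nbhd u u' -> v \in sample (s', t) -> v \in sample (s, t).
Proof.
move=> uU off lt_u /eqP eq_s /eqP eq_s' vD vs'; apply/negPn/negP => vs.
move: eq_s eq_s'; rewrite !sdeg_eq_private => /eqP eq_s /eqP eq_s'.
have same : (nbhd u' :\: nbhd u) :&: sample (s', t) =
            (nbhd u' :\: nbhd u) :&: sample (s, t).
  apply/setP => x; rewrite !in_setI !in_setD.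
  have [//|xu /=] := boolP (x \in nbhd u).
  by congr (_ && _); rewrite !inE (shift_line x uU off) (negbTE xu) addr0.
suff : (#|(nbhd u :\: nbhd u') :&: sample (s, t)| <
        #|(nbhd u :\: nbhd u') :&: sample (s', t)|)%N.
  by rewrite eq_s eq_s' same ltnn.
apply/proper_card/properP; split.
  apply/subsetP => x; rewrite !in_setI !in_setD => /andP[/andP[-> xu] /=].
  rewrite xu !inE /= => /orP[->//|lt_x].
  by apply/orP; right; rewrite (shift_line x uU off) xu; lia.
move: vD; rewrite !in_setD => /and3P[_ vu' vu].
by exists v; rewrite !in_setI !in_setD ?(negbTE vs) vu vu' ?andbF.
Qed.

(** The two cases are the vertices about to enter when their shift increases by
  one, and those about to leave when it decreases by one. *)
Definition at_threshold e v :=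
  (level e.2 v == shift e.1 v) || (level e.2 v == shift e.1 v - 1).

Definition critical u u' : {set weights * thresholds} :=
  [set e | (sdeg e u == sdeg e u') &&
           [exists v in private_nbhd u u', at_threshold e v]].

(** For fixed levels and fixed weights off u, at most one weight of u gives a
  tie with a private neighbour about to enter, and at most one gives a tie with a
  private neighbour about to leave. *)
Lemma card_critical u u' : u \in U ->
  (m.*2.+1 * #|critical u u'| <= 2 * #|{: weights * thresholds}|)%N.
Proof.
move=> uU.
pose E (d : int) := [set e : weights * thresholds | (sdeg e u == sdeg e u') &&
   [exists v in private_nbhd u u', level e.2 v == shift e.1 v - d]].
have notU v : v \in private_nbhd u u' -> v \notin U by case/setDP.
have in_u v : v \in private_nbhd u u' -> v \in nbhd u by case/setDP=> /setDP[].
(* For d = 0 the threshold vertex of e is outside the sample and enters when the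
   weight of u grows to that of e'; for d = 1 the threshold vertex of e' is in
   the sample and leaves when the weight of u drops to that of e. *)
have no_later d e e' : d = 0 \/ d = 1 -> e \in E d -> e' \in E d ->
    (forall w, w != u -> e.1 w = e'.1 w) -> e.2 = e'.2 ->
    (e.1 u < e'.1 u)%N -> False.
  case: e e' => s t [s' t'] d01; rewrite !inE /=.
  move=> /andP[/eqP eq_s /existsP[v /andP[vD /eqP lev]]].
  move=> /andP[/eqP eq_s' /existsP[v' /andP[v'D /eqP lev']]] off eq_t lt_u.
  subst t'; case: d01 => d01; subst d.
    have := sdeg_eq_line uU off lt_u eq_s eq_s' vD.
    rewrite !sample_notin ?notU //= (shift_line v uU off) in_u //; lia.
  have := sdeg_eq_line uU off lt_u eq_s eq_s' v'D.
  move: lev'; rewrite !sample_notin ?notU //=.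
  rewrite (shift_line v' uU off) in_u //; lia.
have bound d : d = 0 \/ d = 1 ->
    (m.*2.+1 * #|E d| <= #|{: weights * thresholds}|)%N.
  move=> d01; apply: (card_line_section (u := u)) => e e' Ee Ee' off eq_t.
  apply: val_inj; case: (ltngtP (e.1 u) (e'.1 u)) => //= lt_u.
    by case: (no_later d e e').
  by case: (no_later d e' e) => // w /off.
have sub : critical u u' \subset E 0 :|: E 1.
  apply/subsetP => e; rewrite !inE => /andP[-> /existsP[v /andP[vD]]] /=.
  by case/orP=> lev; apply/orP; [left|right]; apply/existsP; exists v;
     rewrite vD ?subr0 lev.
have le_sum : (#|critical u u'| <= #|E 0| + #|E 1|)%N.
  exact: leq_trans (subset_leq_card sub) (leq_card_setU _ _).
apply: leq_trans (leq_mul (leqnn _) le_sum) _.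
rewrite mulnDr [leqRHS]mul2n -[leqRHS]addnn.
by apply: leq_add; apply: bound; [left|right].
Qed.

(** For the other vertices both threshold levels, the shift and the shift minus
  one, are available levels. *)
Definition wild s : {set G} := [set v | H%:Z <= `|shift s v|].

Definition stuck (A : {set weights}) u u' : {set weights * thresholds} :=
  [set e | [&& e.1 \in A, sdeg e u == sdeg e u' & e \notin critical u u']].

(** Take a stuck outcome and move the level of one tame private neighbour v of u
  to the threshold, on the side where it already is. The sample, hence the tie, is
  preserved, and the result is critical. Before the move no private neighbour was
  at its threshold, so v can be recognised afterwards, and only the old level of v
  is lost. *)
Lemma card_stuck (A : {set weights}) u u' n :
  (forall s, s \in A -> (n <= #|private_nbhd u u' :\: wild s|)%N) ->
  (n * #|stuck A u u'| <= H.*2.+1 * #|critical u u'|)%N.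
Proof.
move=> many.
pose tgt e v : int :=
  if level e.2 v < shift e.1 v then shift e.1 v - 1 else shift e.1 v.
pose push e v : weights * thresholds :=
  (e.1, upd e.2 v (inord `|(tgt e v + H%:Z)%R|%N)).
have level_push e v : v \notin wild e.1 -> level (push e v).2 v = tgt e v.
  rewrite inE /level upd_at => vT.
  have : `|tgt e v| <= H%:Z by rewrite /tgt; case: ifP => _; lia.
  by move=> tgtH; rewrite inordK; lia.
have sample_push e v : v \notin wild e.1 -> sample (push e v) = sample e.
  move=> vT; apply/setP => x; rewrite !inE; congr (_ || _).
  have [->|xv] := eqVneq x v; last by rewrite /level /= upd_off.
  by rewrite level_push // /tgt /=; case: ifP => _; lia.
have push_threshold e v : v \notin wild e.1 -> at_threshold (push e v) v.
  move=> vT; rewrite /at_threshold level_push // /tgt /=.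
  by case: ifP; rewrite eqxx ?orbT.
(* Double counting of the pairs formed by a stuck outcome and a movable vertex. *)
pose P := [set p : (weights * thresholds) * G |
  (p.1 \in stuck A u u') && (p.2 \in private_nbhd u u' :\: wild p.1.1)].
have memP e v : (e, v) \in P -> [/\ sdeg e u == sdeg e u', e \notin critical u u',
    v \in private_nbhd u u' & v \notin wild e.1].
  by rewrite in_set /= => /andP[]; rewrite in_set => /and3P[_ ? ?] /setDP[].
have leP : (n * #|stuck A u u'| <= #|P|)%N.
  have -> : #|P| = (\sum_(e in stuck A u u')
                    \sum_(v in private_nbhd u u' :\: wild e.1) 1)%N.
    by rewrite -sum1_card pair_big_dep /=; apply: eq_bigl => p; rewrite inE.
  rewrite mulnC -sum_nat_const; apply: leq_sum => e.
  by rewrite inE => /andP[eA _]; rewrite sum1_card many.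
apply: leq_trans leP _.
pose f (p : (weights * thresholds) * G) := (push p.1 p.2, p.1.2 p.2).
have f_inj : {in P &, injective f}.
  move=> [[s t] v] [[s' t'] v'] /memP[eq1 nc1 vD vT] /memP[eq2 nc2 v'D v'T].
  case=> eq_s push_eq eq_v; subst s'.
  have eq_v' : v = v'.
    apply/eqP/negPn/negP => vv'.
    have := push_threshold (s, t) v vT.
    have -> : at_threshold (push (s, t) v) v = at_threshold (s, t') v.
      by rewrite /at_threshold /level /= push_eq upd_off.
    move=> thr; move: nc2; rewrite inE eq2 /= => /existsP; apply.
    by exists v; rewrite vD.
  subst v'; congr (_, _, _); apply/ffunP => x.
  have [->|xv] := eqVneq x v; first exact: eq_v.
  by move/ffunP/(_ x): push_eq; rewrite !upd_off.
have sub : f @: P \subset setX (critical u u') [set: 'I_(H.*2.+1)].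
  apply/subsetP => _ /imsetP[[e v] /memP[eq1 _ vD vT] ->].
  rewrite !in_set andbT /sdeg sample_push // -/(sdeg e u) -/(sdeg e u') eq1 /=.
  by apply/existsP; exists v; rewrite vD push_threshold.
have := subset_leq_card sub.
by rewrite (card_in_imset f_inj) cardsX cardsT card_ord mulnC.
Qed.


(** * Most shifts are small *)

(** Distinct weights are uncorrelated, as reversing one of them changes the sign
  of the product. *)
Lemma sum_weightM w w' : w != w' ->
  \sum_(s : weights) weight s w * weight s w' = 0.
Proof.
move=> ww'; pose flip s := upd s w (rev_ord (s w)).
have flipK : involutive flip.
  move=> s; apply/ffunP => x; have [->|xw] := eqVneq x w.
    by rewrite !upd_at rev_ordK.
  by rewrite !upd_off.
have : \sum_s weight s w * weight s w' = - \sum_s weight s w * weight s w'.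
  rewrite {1}(reindex_inj (inv_inj flipK)) /= -sumrN; apply: eq_bigr => s _.
  rewrite /weight upd_at upd_off 1?eq_sym // -mulNr; congr (_ * _).
  have := ltn_ord (s w); rewrite /= subSS; move: (s w : nat) => k km; lia.
by move=> /eqP; rewrite -subr_eq0 opprK -mulr2n mulrn_eq0 /= => /eqP.
Qed.

Lemma sum_shift_sqr v :
  \sum_(s : weights) shift s v ^+ 2 <= (#|U| * m ^ 2 * #|{: weights}|)%N%:Z.
Proof.
under eq_bigr => s _ do rewrite expr2 /shift big_distrlr /=.
rewrite exchange_big /=.
apply: (@le_trans _ _ (\sum_(w in U) (m ^ 2 * #|{: weights}|)%N%:Z)); last first.
  by rewrite sumz_const mulnA.
rewrite [leLHS]big_mkcondr /=; apply: ler_sum => w wU; case: ifP => // wv.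
rewrite exchange_big /= (bigD1 w) ?wU //= [X in _ + X]big1 ?addr0; last first.
  by move=> w' /andP[_ w'w]; rewrite sum_weightM // eq_sym.
apply: (@le_trans _ _ (\sum_(s : weights) (m ^ 2)%N%:Z)).
  apply: ler_sum => s _; rewrite /weight -mulnn PoszM.
  by have := ltn_ord (s w); nia.
by rewrite sumz_const mulnC.
Qed.

(** Chebyshev's inequality, summed over all vertices. *)
Lemma sum_card_wild :
  (H ^ 2 * \sum_(s : weights) #|wild s| <= #|G| * #|U| * m ^ 2 * #|{: weights}|)%N.
Proof.
have dc : (\sum_(s : weights) #|wild s| =
           \sum_(v in G) \sum_(s : weights) (v \in wild s))%N.
  rewrite exchange_big; apply: eq_bigr => s _ /=.
  by rewrite -sum1_card big_mkcond; apply: eq_bigl => v; rewrite inE.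
rewrite dc big_distrr /= -(mulnA #|G|) -(mulnA #|G|) -(sum_nat_const G).
apply: leq_sum => v _; rewrite -lez_nat.
apply: le_trans (sum_shift_sqr v); rewrite PoszM (big_morph Posz PoszD erefl).
rewrite mulr_sumr; apply: ler_sum => s _; rewrite inE.
case: (lerP H%:Z `|shift s v|) => /= h; last by rewrite mulr0 sqr_ge0.
by rewrite mulr1 -mulnn PoszM expr2; nia.
Qed.

End RandomSample.

(** * A sample with few collisions *)

Lemma card_symdiff_private (G : sgraph) (U : {set G}) (u u' : G) :
  (#|symdiff (nbhd u) (nbhd u')| <=
   #|U| + (#|private_nbhd U u u'| + #|private_nbhd U u' u|))%N.
Proof.
have sub : symdiff (nbhd u) (nbhd u') \subset
    U :|: (private_nbhd U u u' :|: private_nbhd U u' u).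
  apply/subsetP => v; rewrite !in_setU !in_setD.
  by case: (v \in U).
apply: leq_trans (subset_leq_card sub) _.
by apply: leq_trans (leq_card_setU _ _) _; rewrite leq_add2l leq_card_setU.
Qed.

Section Spread.
Variables (G : sgraph) (U : {set G}) (q : nat).
Hypotheses (q_gt0 : (0 < q)%N) (G_gt0 : (0 < #|G|)%N).
Hypothesis U_small : (#|U| ^ 3 <= #|G| ^ 2)%N.
Hypothesis U_sparse : (2 * q * #|U| <= #|G|)%N.
Hypothesis U_diverse : forall u u', u \in U -> u' \in U -> u != u' ->
  (#|G| <= q * #|symdiff (nbhd u) (nbhd u')|)%N.

(* With weights of size |U| the shifts have standard deviation at most
   |U|^(3/2) <= |G|; the factor 4 q makes wild vertices rare compared with the
   larger private neighbourhood, which has at least |G| / (4 q) elements. *)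
Let m := #|U|.
Let H := (4 * q * #|G|)%N.
Notation weights := {ffun G -> 'I_(m.*2.+1)}.
Notation thresholds := {ffun G -> 'I_(H.*2.+1)}.
Implicit Types (s : weights) (e : weights * thresholds).

Definition tame : {set weights} :=
  [set s | (8 * q * #|wild U H s| <= #|G|)%N].

(** Markov's inequality for the number of wild vertices. *)
Lemma card_tame : (#|{: weights}| <= 2 * #|tame|)%N.
Proof.
have markov : (#|G| * #|~: tame| <= 8 * q * \sum_(s : weights) #|wild U H s|)%N.
  rewrite mulnC -sum_nat_const big_distrr /= [leqRHS](bigID (mem (~: tame))) /=.
  apply: leq_trans (leq_addr _ _); apply: leq_sum => s.
  by rewrite !inE -ltnNge => /ltnW.
have cheb := sum_card_wild U m H.
move: markov cheb; rewrite -(cardsC tame).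
move: (\sum_s _)%N #|tame| #|~: tame| => S x y markov cheb.
have : (16 * q ^ 2 * #|G| ^ 3 * y <= 8 * q * #|G| ^ 3 * (x + y))%N.
  apply: (@leq_trans (8 * q * (H ^ 2 * S))%N).
    have := leq_mul (leqnn (H ^ 2)) markov; rewrite /H.
    move: #|G| => N; nia.
  apply: (@leq_trans (8 * q * (#|G| * m ^ 3 * (x + y)))%N).
    rewrite leq_mul2l; apply/orP; right; apply: leq_trans cheb _.
    by rewrite !expnS expn0 !muln1 !mulnA.
  have := leq_mul (leqnn (#|G| * (x + y))) U_small; rewrite -/m.
  move: #|G| (m ^ 3)%N => N M; nia.
have N3 : (0 < 8 * q * #|G| ^ 3)%N 
  by rewrite !muln_gt0 q_gt0 G_gt0.
have -> : (16 * q ^ 2 * #|G| ^ 3 * y = 8 * q * #|G| ^ 3 * (2 * q * y))%N.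
  by move: (#|G| ^ 3)%N => M; nia.
rewrite leq_pmul2l //; nia.
Qed.

Definition collision u u' : {set weights * thresholds} :=
  [set e | (e.1 \in tame) && (sdeg U e u == sdeg U e u')].

(** A tie is either critical or stuck. In a tame outcome at least half of the
  private neighbours of u are not wild, which makes stuck outcomes at most 72 q^2
  times as numerous as critical ones. *)
Lemma card_collision_oriented u u' : u \in U ->
  (#|G| <= 4 * q * #|private_nbhd U u u'|)%N ->
  (m.*2.+1 * #|collision u u'| <= 146 * q ^ 2 * #|{: weights * thresholds}|)%N.
Proof.
move=> uU many.
pose n := (#|private_nbhd U u u'| - #|G| %/ (8 * q))%N.
have n_many : (#|G| <= 8 * q * n)%N.
  have := leq_divM #|G| (8 * q); rewrite /n.
  move: many; move: #|G| (#|G| %/ _)%N #|private_nbhd U u u'|.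
  by move=> N d p; rewrite mulnBr; nia.
have le_stuck : (n * #|stuck U H tame u u'| <= H.*2.+1 * #|critical U m H u u'|)%N.
  apply: card_stuck => s; rewrite inE => s_tame.
  have wild_small : (#|wild U H s| <= #|G| %/ (8 * q))%N.
    by rewrite leq_divRL ?muln_gt0 // mulnC.
  rewrite cardsD /n; apply: leq_sub2l; apply: leq_trans wild_small.
  exact/subset_leq_card/subsetIr.
have sub : collision u u' \subset stuck U H tame u u' :|: critical U m H u u'.
  apply/subsetP => e; rewrite in_setU in_set => /andP[e_tame eq_e].
  rewrite in_set e_tame eq_e /=; exact: orNb.
have le_coll := leq_trans (subset_leq_card sub) (leq_card_setU _ _).
have le_crit := card_critical m H u' uU.
move: le_stuck le_coll le_crit.
move: #|collision u u'| #|stuck _ _ _ u u'| #|critical U m H u u'| => c x y.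
move: #|{: weights * thresholds}| => z le_x le_c le_y.
have x_le : (x <= 72 * q ^ 2 * y)%N.
  rewrite -(leq_pmul2l G_gt0).
  apply: (@leq_trans (8 * q * (n * x))%N); first by rewrite mulnA leq_mul2r n_many orbT.
  apply: (@leq_trans (8 * q * (H.*2.+1 * y))%N); first by rewrite leq_mul2l le_x orbT.
  have H_le : (H.*2.+1 <= 9 * (q * #|G|))%N.
    have : (0 < q * #|G|)%N by rewrite muln_gt0 q_gt0.
    by rewrite /H -mulnA; move: (q * #|G|)%N => N; lia.
  have := leq_mul H_le (leqnn (8 * q * y)); rewrite -mulnn.
  by move: H.*2.+1 #|G| => L N; lia.
have c_le : (c <= 73 * q ^ 2 * y)%N.
  have : (y <= q ^ 2 * y)%N by rewrite leq_pmull // expn_gt0 q_gt0.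
  by move: x_le le_c; rewrite -!mulnA; move: (q ^ 2 * y)%N => Y; lia.
apply: (@leq_trans (73 * q ^ 2 * (m.*2.+1 * y))%N).
  have := leq_mul (leqnn m.*2.+1) c_le.
  by move: (q ^ 2)%N m.*2.+1 => Q M; lia.
have := leq_mul (leqnn (73 * q ^ 2)) le_y.
by move: (q ^ 2)%N m.*2.+1 => Q M; lia.
Qed.

(** Diversity makes the private neighbourhood large for one of the two vertices,
  and ties do not depend on the order of the vertices. *)
Lemma card_collision u u' : u \in U -> u' \in U -> u != u' ->
  (m.*2.+1 * #|collision u u'| <= 146 * q ^ 2 * #|{: weights * thresholds}|)%N.
Proof.
move=> uU u'U uu'.
have := U_diverse uU u'U uu'; have := card_symdiff_private U u u'.
rewrite -/m; move: #|symdiff _ _| => D le_D many.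
have [|] : (#|G| <= 4 * q * #|private_nbhd U u u'|)%N \/
       (#|G| <= 4 * q * #|private_nbhd U u' u|)%N.
- apply/orP; move: U_sparse le_D many; rewrite -/m.
  move: #|G| #|private_nbhd U u u'| #|private_nbhd U u' u| => N a b; nia.
- exact: card_collision_oriented.
have -> : collision u u' = collision u' u.
  by apply/setP => e; rewrite !inE eq_sym.
exact: card_collision_oriented.
Qed.

Definition colliding_pairs e : {set G * G} :=
  [set p in setX U U | (p.1 != p.2) && (sdeg U e p.1 == sdeg U e p.2)].

(** Averaging over the tame outcomes, which are at least half of all outcomes. *)
Lemma few_colliding_pairs : (0 < m)%N ->
  exists e, (#|colliding_pairs e| < 146 * q ^ 2 * m)%N.
Proof.
move=> m_gt0.
have [/existsP//|/existsPn many] :=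
  boolP [exists e, (#|colliding_pairs e| < 146 * q ^ 2 * m)%N].
pose good := setX tame [set: thresholds].
have lower : (#|good| * (146 * q ^ 2 * m) <=
              \sum_(e in good) #|colliding_pairs e|)%N.
  rewrite -sum_nat_const; apply: leq_sum => e _.
  by have := many e; rewrite -leqNgt.
have swap : (\sum_(e in good) #|colliding_pairs e| =
   \sum_(p in setX U U | p.1 != p.2) #|collision p.1 p.2|)%N.
  rewrite (eq_bigr (fun e => \sum_(p in setX U U | p.1 != p.2)
                               (sdeg U e p.1 == sdeg U e p.2)))%N; last first.
    move=> e _; rewrite -sum1_card [RHS]big_mkcond [LHS]big_mkcond /=.
    apply: eq_bigr => p _; rewrite in_set andbA andbC.
    by case: (sdeg _ _ _ == _); case: ifP.
  rewrite exchange_big /=; apply: eq_bigr => p _.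
  rewrite -sum1_card [RHS]big_mkcond [LHS]big_mkcond /=; apply: eq_bigr => e _.
  by rewrite !in_set andbT; rewrite andbC; case: (sdeg _ _ _ == _); case: ifP.
have upper : (m.*2.+1 * \sum_(e in good) #|colliding_pairs e| <=
   m ^ 2 * (146 * q ^ 2 * #|{: weights * thresholds}|))%N.
  rewrite swap big_distrr /= -mulnn -cardsX -sum_nat_const.
  rewrite big_mkcondr /=; apply: leq_sum => -[u u'] /setXP[/= uU u'U].
  by case: ifP => // uu'; apply: card_collision.
have half : (#|{: weights * thresholds}| <= 2 * #|good|)%N.
  by rewrite cardsX cardsT card_prod mulnA leq_mul2r card_tame orbT.
have Omega_gt0 : (0 < #|{: weights * thresholds}|)%N.
  by apply/card_gt0P; exists ([ffun=> ord0], [ffun=> ord0]).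
move: lower upper half Omega_gt0; move: (\sum_(e in good) _)%N #|good| => S g.
move: #|{: weights * thresholds}| => z lower upper half z_gt0.
have q2 : (0 < 146 * q ^ 2 * m)%N by rewrite !muln_gt0 q_gt0 m_gt0.
have : (m.*2.+1 * z <= 2 * m * z)%N.
  rewrite -(leq_pmul2l q2).
  have := leq_mul (leqnn m.*2.+1) lower => /leq_trans/(_ upper).
  have := leq_mul (leqnn (m.*2.+1 * (146 * q ^ 2 * m))) half.
  by rewrite -mulnn; move: (146 * q ^ 2)%N => c; lia.
by rewrite leq_pmul2r //; lia.
Qed.

(** Adding the |U| diagonal pairs to the few colliding ones turns 146 into 147
  and makes [card_collisions] applicable. *)
Lemma spread_subset : exists2 W : {set G}, U \subset W &
  (#|U| <= 147 * q ^ 2 * size (undup [seq #|nbhd u :&: W| | u in U]))%N.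
Proof.
have [m0|m_gt0] := posnP m; first by exists U; rewrite // -/m m0.
have [e few] := few_colliding_pairs m_gt0.
exists (sample U e); first exact: subsetUl.
have cs := card_collisions U (sdeg U e).
have pairs : (#|[set p in setX U U | sdeg U e p.1 == sdeg U e p.2]| <=
              147 * q ^ 2 * m)%N.
  have sub : [set p in setX U U | sdeg U e p.1 == sdeg U e p.2] \subset
      colliding_pairs e :|: [set (u, u) | u in U].
    apply/subsetP => -[u u']; rewrite !inE /= => /andP[/andP[uU u'U] eq_d].
    rewrite uU u'U eq_d andbT /=; have [<-|//] := eqVneq u u'.
    by apply/imsetP; exists u.
  have le := leq_trans (subset_leq_card sub) (leq_card_setU _ _).
  have := leq_trans le (leq_add (leqnn _) (leq_imset_card _ _)).
  have m_le : (m <= q ^ 2 * m)%N by rewrite leq_pmull // expn_gt0 q_gt0.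
  move/leq_trans; apply; apply: leq_trans (leq_add (ltnW few) m_le) _.
  by rewrite -!mulnA addnC -mulSn.
move: cs pairs; rewrite -/m /sdeg; move: (size _) #|[set _ in _ | _]| => d p cs pairs.
rewrite -(leq_pmul2l m_gt0) mulnn; apply: leq_trans cs _.
by have := leq_mul (leqnn d) pairs; nia.
Qed.

End Spread.

(** * Degrees in induced subgraphs, and the exponent 2/3 *)

Lemma degree_induced (G : sgraph) (W : {set G}) (x : induced W) :
  degree x = #|nbhd (val x) :&: W|.
Proof.
rewrite /degree -(card_imset _ val_inj); apply: eq_card => v.
rewrite !inE; apply/imsetP/andP => [[y] | [xv vW]].
  by rewrite inE => xy ->; split; [exact: xy | exact: valP].
by exists (exist _ v vW) => //; rewrite inE.
Qed.

Lemma leq_num_distinct_degrees (G : sgraph) (U W : {set G}) : U \subset W ->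
  (size (undup [seq #|nbhd u :&: W| | u in U]) <=
   num_distinct_degrees (induced W))%N.
Proof.
move=> /subsetP UW; apply: uniq_leq_size; first exact: undup_uniq.
move=> d; rewrite !mem_undup => /imageP[u uU ->]; apply/imageP.
by exists (exist _ u (UW u uU)) => //; rewrite degree_induced.
Qed.

Lemma num_distinct_degrees_gt0 (G : sgraph) :
  (0 < #|G|)%N -> (0 < num_distinct_degrees G)%N.
Proof.
case/card_gt0P=> x _.
have : degree x \in undup [seq degree v | v : G].
  by rewrite mem_undup; apply/imageP; exists x.
by rewrite /num_distinct_degrees; case: (undup _).
Qed.

Lemma powR_two_thirds_cubed (R : realType) (x : R) :
  0 <= x -> (x `^ (2 / 3)) ^+ 3 = x ^+ 2.
Proof.
move=> x_ge0; rewrite -powR_mulrn ?powR_ge0 // -powRrM.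
by rewrite divfK ?pnatr_eq0 // powR_mulrn.
Qed.

Theorem theorem2 (R : realType) (delta : R) (hdelta : 0 < delta) :
  exists2 c : R, 0 < c &
    forall (N : nat) (G : sgraph), #|G| = N ->
      (exists2 U : {set G}, diverse delta U & N%:R `^ (2 / 3) <= #|U|%:R :> R) ->
      exists W : {set G},
        c * N%:R `^ (2 / 3) <= (num_distinct_degrees (induced W))%:R.
Proof.
pose q := (Num.trunc delta^-1).+1.
have q_delta : 1 <= q%:R * delta.
  by rewrite -ler_pdivrMr // div1r ltW // truncnS_gt.
have q1 : 1 <= q%:R :> R by rewrite ler1n.
(* The factor 294 is 2 * 147, since N^(2/3) <= 2 K for its integer part K. The
   third power of q covers the graphs with fewer than 8 q^3 vertices, for which
   one degree is enough. *)
pose c : R := (294 * q ^ 3)%N%:R^-1.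
exists c; first by rewrite invr_gt0 ltr0n muln_gt0 expn_gt0.
move=> N G cardG [U U_div U_large].
have [N0 | N_gt0] := posnP N.
  by exists set0; rewrite N0 powR0 ?mulr0 ?ler0n // mulf_neq0 ?invr_eq0 ?pnatr_eq0.
have N1 : 1 <= N%:R :> R by rewrite ler1n.
set x : R := N%:R `^ (2 / 3) in U_large *.
have x_ge0 : 0 <= x by exact: powR_ge0.
have x3 : x ^+ 3 = N%:R ^+ 2 by exact: powR_two_thirds_cubed.
have [N_small | N_large] := ltnP N (8 * q ^ 3).
  exists setT.
  have x_le : x <= N%:R.
    rewrite -(ler_pXn2r (n := 3)) ?nnegrE // x3.
    by rewrite (exprS _ 2) ler_peMl ?exprn_ge0.
  apply: (@le_trans _ _ 1).
    rewrite mulrC ler_pdivrMr ?ltr0n ?muln_gt0 ?expn_gt0 // mul1r.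
    by apply: le_trans x_le _; rewrite ler_nat; lia.
  rewrite ler1n num_distinct_degrees_gt0 // card_sig.
  by rewrite (eq_card (B := G)) ?cardG // => v; rewrite !inE.
pose K := Num.trunc x.
have /andP[K_le x_lt] : K%:R <= x < K.+1%:R by rewrite truncn_itv.
have K_gt0 : (0 < K)%N.
  rewrite truncn_gt0 -(ler_pXn2r (n := 3)) ?nnegrE // expr1n x3.
  exact: exprn_ege1.
have K3 : (K ^ 3 <= N ^ 2)%N.
  by rewrite -(ler_nat R) !natrX -x3 lerXn2r ?nnegrE.
have K_sparse : (2 * q * K <= N)%N.
  rewrite -(leq_exp2r _ _ (isT : 0 < 3)%N) expnMn (expnMn 2).
  apply: leq_trans (leq_mul (leqnn _) K3) _.
  by rewrite (expnS N 2) leq_mul2r N_large orbT.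
have /card_geqP[s [s_uniq s_size sU]] : (K <= #|U|)%N.
  by rewrite -(ler_nat R) (le_trans K_le).
pose V := [set u in s].
have cardV : #|V| = K by rewrite cardsE (card_uniqP s_uniq).
have V_div u u' : u \in V -> u' \in V -> u != u' ->
    (#|G| <= q * #|symdiff (nbhd u) (nbhd u')|)%N.
  rewrite !inE => /sU uU /sU u'U uu'; rewrite -(ler_nat R) natrM.
  apply: le_trans (ler_wpM2l _ (U_div u u' uU u'U uu')) => //.
  by rewrite mulrA ler_peMl.
have [||||W VW W_many] := @spread_subset G V q _ _ _ _ V_div;
  rewrite ?cardV ?cardG //.
exists W.
rewrite mulrC ler_pdivrMr ?ltr0n ?muln_gt0 ?expn_gt0 //.
apply: (le_trans (ltW x_lt)); rewrite -natrM ler_nat.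
have := leq_num_distinct_degrees VW; rewrite cardV in W_many.
move: W_many; move: (size _) (num_distinct_degrees _) => d D W_many dD.
have q23 : (q ^ 2 <= q ^ 3)%N by rewrite leq_pexp2l.
apply: (@leq_trans (2 * (147 * q ^ 2 * d))%N); first by lia.
have := leq_mul q23 dD; move: (q ^ 2)%N (q ^ 3)%N => Q2 Q3; lia.
Qed.
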